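(* Consider a single-commodity network congestion game with unknown demands and affine costs. Let $\mu^{(1)},\mu^{(2)}\in\Delta(\Theta)$ be such that $$\frac{\sum_{\theta\in\Theta}\mu^{(1)}_\theta d_\theta^2}{\sum_{\theta\in\Theta}\mu^{(1)}_\theta d_\theta}<\frac{\sum_{\theta\in\Theta}\mu^{(2)}_\theta d_\theta^2}{\sum_{\theta\in\Theta}\mu^{(2)}_\theta d_\theta}\qquad\text{and}\qquad\sum_{\theta\in\Theta}\mu^{(1)}_\theta d_\theta<\sum_{\theta\in\Theta}\mu^{(2)}_\theta d_\theta.$$ Then $C(\mu^{(1)})\le C(\mu^{(2)})$.
   Context: Network congestion game with unknown demand (single commodity). $G=(V,E)$ is a directed graph with source $s\in V$ and destination $t\in V$. Every edge $e$ has an affine cost function $c_e(x)=a_e x+b_e$ with $a_e\in\mathbb{R}_{>0}$, $b_e\in\mathbb{R}_{\ge 0}$. $\Theta=\{\theta_1,\dots,\theta_l\}$ is a finite set of states of nature; state $\theta$ is associated with a demand $d_\theta$, where $0<d_{\theta_1}<\dots<d_{\theta_l}=1$. $\Delta(\Theta)$ is the set of probability distributions on $\Theta$. $\mathcal{P}$ is the set of directed $s$-$t$-paths. A path flow is a vector $x=(x_P)_{P\in\mathcal{P}}$ with $x_P\ge 0$ and $\sum_{P}x_P=1$. The load of $x$ on $e$ is $x_e=\sum_{P\in\mathcal{P}:e\in P}x_P$. For $\mu\in\Delta(\Theta)$ the expected cost of $e$ is $c_e(x_e\mid\mu)=\sum_{\theta\in\Theta}\mu_\theta d_\theta c_e(d_\theta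 x_e)=a_e\bigl(\sum_\theta\mu_\theta d_\theta^2\bigr)x_e+b_e\sum_\theta\mu_\theta d_\theta$ and that of a path is $c_P(x\mid\mu)=\sum_{e\in P}c_e(x_e\mid\mu)$. A path flow $x$ is a Wardrop equilibrium for $\mu$ if $c_P(x\mid\mu)\le c_Q(x\mid\mu)$ for all $P,Q\in\mathcal{P}$ with $x_P>0$. The Wardrop equilibrium $x^*(\mu)$ is unique (in terms of edge loads), and $C(\mu)=\sum_{e\in E}x^*_e(\mu)\,c_e(x^*_e(\mu)\mid\mu)$ is its total cost. *)

(* Defs.v *)
(* MathComp / MathComp-Analysis *)
From HB Require Import structures.
From mathcomp Require Import all_boot all_order all_algebra.
From mathcomp Require Import all_classical all_reals all_analysis.
From mathcomp Require Import ring lra.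

Set Implicit Arguments.
Unset Strict Implicit.
Unset Printing Implicit Defensive.

Import Order.TTheory GRing.Theory Num.Theory.
Import numFieldNormedType.Exports.
Local Open Scope ring_scope.

(* A walk from u to v, given as its sequence of edges.  Edges are abstract and
   carry their endpoints, so parallel edges are allowed. *)
Fixpoint is_walk (V E : finType) (src tgt : E -> V) (u : V) (p : seq E) (v : V)
    : bool :=
  if p is e :: p' then (src e == u) && is_walk src tgt (tgt e) p' v else u == v.

(* Paths do not repeat vertices. *)
Definition is_path (V E : finType) (src tgt : E -> V) (u : V) (p : seq E)
    (v : V) : bool :=
  is_walk src tgt u p v && uniq (u :: map tgt p).

(* There are ngame_states.+1 states of nature, numbered by increasing demand. *)
Record game (R : realType) := Game {
  vertex : finType;
  edge : finType;
  src : edge -> vertex;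
  tgt : edge -> vertex;
  source : vertex;
  destination : vertex;
  destination_reachable : exists p, is_path src tgt source p destination;
  slope : edge -> R;
  slope_gt0 : forall e, 0 < slope e;
  offset : edge -> R;
  offset_ge0 : forall e, 0 <= offset e;
  ngame_states : nat;
  demand : 'I_ngame_states.+1 -> R;
  demand_gt0 : forall th, 0 < demand th;
  demand_increasing :
    forall th th' : 'I_ngame_states.+1, (th < th')%N -> demand th < demand th';
  demand_max : demand ord_max = 1
}.

Arguments src {R} _ _.
Arguments tgt {R} _ _.
Arguments source {R} _.
Arguments destination {R} _.
Arguments slope {R} _ _.
Arguments offset {R} _ _.
Arguments demand {R} _ _.

Definition state (R : realType) (G : game R) : finType := 'I_(ngame_states G).+1.

Record belief (R : realType) (G : game R) := Belief {
  prob :> state G -> R;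
  prob_ge0 : forall th, 0 <= prob th;
  prob_sum1 : \sum_th prob th = 1
}.

(* The length bound only serves to obtain a finite type; it excludes no path,
   see spath_complete. *)
Definition spath (R : realType) (G : game R) : finType :=
  {p : #|vertex G|.-bseq (edge G) |
     is_path (src G) (tgt G) (source G) p (destination G)}.

Definition edges (R : realType) (G : game R) (P : spath G) : seq (edge G) :=
  val (val P).

Definition path_flow (R : realType) (G : game R) (x : spath G -> R) : Prop :=
  (forall P, 0 <= x P) /\ \sum_P x P = 1.

Definition load (R : realType) (G : game R) (x : spath G -> R) (e : edge G) : R :=
  \sum_(P : spath G | e \in edges P) x P.

Definition edge_cost (R : realType) (G : game R) (e : edge G) (y : R) : R :=
  slope G e * y + offset G e.

(* In state th the actual load is demand th * y and its cost is paid by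
   demand th units of traffic. *)
Definition exp_edge_cost (R : realType) (G : game R) (mu : belief G)
    (e : edge G) (y : R) : R :=
  \sum_th mu th * demand G th * edge_cost e (demand G th * y).

Definition exp_path_cost (R : realType) (G : game R) (mu : belief G)
    (x : spath G -> R) (P : spath G) : R :=
  \sum_(e in edges P) exp_edge_cost mu e (load x e).

Definition wardrop (R : realType) (G : game R) (mu : belief G)
    (x : spath G -> R) : Prop :=
  path_flow x /\
  forall P Q : spath G,
    0 < x P -> exp_path_cost mu x P <= exp_path_cost mu x Q.

Definition total_cost (R : realType) (G : game R) (mu : belief G)
    (x : spath G -> R) : R :=
  \sum_(e : edge G) load x e * exp_edge_cost mu e (load x e).

Definition moment1 (R : realType) (G : game R) (mu : belief G) : R :=
  \sum_th mu th * demand G th.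

Definition moment2 (R : realType) (G : game R) (mu : belief G) : R :=
  \sum_th mu th * demand G th ^+ 2.

Lemma spath_complete (R : realType) (G : game R) (p : seq (edge G)) :
  is_path (src G) (tgt G) (source G) p (destination G) ->
  exists P : spath G, edges P = p.
Proof.
move=> pP.
have sp : (size p <= #|vertex G|)%N.
  case/andP: (pP) => _ /andP[_ /card_uniqP].
  by rewrite size_map => <-; exact: max_card.
by exists (exist _ (Bseq sp) pP).
Qed.

Lemma exp_edge_costE (R : realType) (G : game R) (mu : belief G)
    (e : edge G) (y : R) :
  exp_edge_cost mu e y =
    slope G e * moment2 mu * y + offset G e * moment1 mu.
Proof.
rewrite /exp_edge_cost /moment2 /moment1 -mulrA mulr_suml !mulr_sumr -big_split.
by apply: eq_bigr => th _; rewrite /edge_cost /=; ring.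
Qed.

Lemma moment2_gt0 (R : realType) (G : game R) (mu : belief G) : 0 < moment2 mu.
Proof.
have m0 th : 0 <= mu th * demand G th ^+ 2.
  by rewrite mulr_ge0 ?prob_ge0 // sqr_ge0.
rewrite lt_neqAle sumr_ge0 // andbT eq_sym; apply/eqP => m2.
have mu0 th : mu th = 0.
  have /eqP := @psumr_eq0P _ _ xpredT _ (fun i _ => m0 i) m2 th isT.
  rewrite mulf_eq0 sqrf_eq0 => /orP[/eqP //|/eqP d0].
  by have := demand_gt0 th; rewrite d0 ltxx.
have := prob_sum1 mu; rewrite big1 // => /eqP.
by rewrite eq_sym oner_eq0.
Qed.

Lemma load_sumE (R : realType) (G : game R) (c : edge G -> R)
    (x : spath G -> R) :
  \sum_e load x e * c e = \sum_P x P * \sum_(e in edges P) c e.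
Proof.
under eq_bigr do rewrite mulr_suml.
rewrite (exchange_big_dep xpredT) //=.
by apply: eq_bigr => P _; rewrite mulr_sumr.
Qed.

Lemma wardrop_le (R : realType) (G : game R) (mu : belief G)
    (x y : spath G -> R) : wardrop mu x -> path_flow y ->
  \sum_P x P * exp_path_cost mu x P <= \sum_P y P * exp_path_cost mu x P.
Proof.
move=> [[x0 x1] xW] [y0 y1].
have -> : \sum_P x P * exp_path_cost mu x P =
    \sum_P \sum_Q x P * y Q * exp_path_cost mu x P.
  apply: eq_bigr => P _; rewrite -mulr_suml -mulr_sumr y1 mulr1 //.
have -> : \sum_P y P * exp_path_cost mu x P =
    \sum_P \sum_Q x P * y Q * exp_path_cost mu x Q.
  rewrite exchange_big; apply: eq_bigr => P _ /=.
  by rewrite -mulr_suml -mulr_suml x1 mul1r.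
apply: ler_sum => P _; apply: ler_sum => Q _.
have := x0 P; rewrite le_eqVlt => /orP[/eqP <-|xP]; first by rewrite !mul0r.
by rewrite ler_wpM2l ?mulr_ge0 // xW.
Qed.

(* Wardrop equilibria are unique in terms of edge loads. *)
Lemma wardrop_load_unique (R : realType) (G : game R) (mu : belief G)
    (x y : spath G -> R) : wardrop mu x -> wardrop mu y -> load x =1 load y.
Proof.
move=> xW yW.
have := lerD (wardrop_le xW yW.1) (wardrop_le yW xW.1).
rewrite /exp_path_cost -!load_sumE -!big_split /= -subr_le0 -sumrB.
under eq_bigr => e _.
  rewrite !exp_edge_costE.
  rewrite (_ : _ - _ = slope G e * moment2 mu * (load x e - load y e) ^+ 2);
    last by ring.
  over.
have t0 e : 0 <= slope G e * moment2 mu * (load x e - load y e) ^+ 2.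
  by rewrite mulr_ge0 ?sqr_ge0 // mulr_ge0 // ltW ?slope_gt0 ?moment2_gt0.
move=> s0 e.
have {}s0 : \sum_e slope G e * moment2 mu * (load x e - load y e) ^+ 2 = 0.
  by apply/eqP; rewrite eq_le s0 sumr_ge0.
have /eqP := @psumr_eq0P _ _ xpredT _ (fun i _ => t0 i) s0 e isT.
rewrite !mulf_eq0 (gt_eqF (slope_gt0 e)) (gt_eqF (moment2_gt0 mu)) /=.
by rewrite orbb subr_eq0 => /eqP.
Qed.

(* Beckmann potential. *)
Definition potential (R : realType) (G : game R) (mu : belief G)
    (x : spath G -> R) : R :=
  \sum_e (slope G e * moment2 mu * load x e ^+ 2 / 2
          + offset G e * moment1 mu * load x e).

Lemma potential_min_exists (R : realType) (G : game R) (mu : belief G) :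
  exists x : spath G -> R, path_flow x /\
    forall y, path_flow y -> potential mu x <= potential mu y.
Proof.
pose T : topologicalType := prod_topology (fun _ : spath G => R^o : topologicalType).
have projc (P : spath G) : continuous (fun x : T => x P : R^o).
  exact: (@proj_continuous (spath G) (fun=> R^o) P).
pose A : set T := @path_flow R G.
have Ane : (A !=set0)%classic.
  have [p /spath_complete[P _]] := destination_reachable G.
  exists (fun Q => (Q == P)%:R); split=> [Q|]; first exact: ler0n.
  by rewrite (bigD1 P) //= eqxx big1 ?addr0 // => Q /negPf ->.
have sumc (p : pred (spath G)) :
    continuous (fun x : T => \sum_(P | p P) x P : R^o).
  by apply: continuous_big => [|P _]; [exact: add_continuous | exact: projc].
have Acpt : compact A.
  have B : compact [set x : T | forall P, (`[0, 1]%classic : set R^o) (x P)].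
    apply: (@tychonoff _ (fun=> R^o) (fun=> `[0, 1]%classic)) => _.
    exact: segment_compact.
  have C : closed ((fun x : T => \sum_P x P : R^o) @^-1` [set y | y = 1])%classic.
    by apply: preimage_closed; [move=> x _; exact: sumc | exact: closed_eq].
  have := compact_closedI B C; congr compact.
  apply/seteqP; split=> x /=.
    move=> [x01 x1]; split=> // P.
    by have := x01 P; rewrite /= in_itv /= => /andP[].
  move=> [x0 x1]; split=> // P; rewrite /= in_itv /= x0 /= -x1.
  by rewrite (bigD1 P) //= lerDl sumr_ge0.
have phic : continuous (potential mu : T -> R).
  apply: continuous_big => [|e _ x]; first exact: add_continuous.
  apply: (@continuous_comp _ _ _
    (fun y : T => \sum_(P | e \in edges P) y P : R)
    (fun z : R => slope G e * moment2 mu * z ^+ 2 / 2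
                  + offset G e * moment1 mu * z)).
    exact: sumc.
  apply: cvgD; last by apply: cvgM; [exact: cvg_cst | exact: cvg_id].
  apply: cvgM; last exact: cvg_cst.
  by apply: cvgM; [exact: cvg_cst | exact: exprn_continuous].
have [x xA xmin] := compact_EVT_min Ane Acpt (continuous_subspaceT phic).
exists x; split; first by move: xA; rewrite inE.
by move=> y yA; apply: xmin; rewrite inE.
Qed.

Lemma wardrop_exists (R : realType) (G : game R) (mu : belief G) :
  exists x : spath G -> R, wardrop mu x.
Proof.
have [x [[x0 x1] xmin]] := potential_min_exists mu.
exists x; split=> // P Q xP; rewrite leNgt; apply/negP => lt_QP.
have neqPQ : P != Q by apply: contraTneq lt_QP => ->; rewrite ltxx.
pose dl e : R := (e \in edges Q)%:R - (e \in edges P)%:R.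
pose D := exp_path_cost mu x P - exp_path_cost mu x Q.
pose K := \sum_e slope G e * moment2 mu * dl e ^+ 2 / 2.
have D0 : 0 < D by rewrite subr_gt0.
have K0 : 0 <= K.
  apply: sumr_ge0 => e _; rewrite mulr_ge0 ?invr_ge0 ?ler0n // mulr_ge0 ?sqr_ge0 //.
  by rewrite mulr_ge0 // ltW ?slope_gt0 ?moment2_gt0.
pose eps := Num.min (x P) (D / (K + 1)).
have eps0 : 0 < eps by rewrite lt_min xP divr_gt0 // ltr_wpDl.
pose y S := x S + eps * ((S == Q)%:R - (S == P)%:R).
have sum_delta (p : pred (spath G)) (S : spath G) :
    \sum_(i | p i) (i == S)%:R = (p S)%:R :> R.
  rewrite big_mkcond (bigD1 S) //= eqxx big1 ?addr0; first by case: (p S).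
  by move=> i /negPf ->; case: (p i).
have yF : path_flow y.
  split=> [S|]; last first.
    by rewrite big_split /= -mulr_sumr sumrB !sum_delta subrr mulr0 addr0.
  rewrite /y; have [-> | SP] := eqVneq S P.
    by rewrite (negPf neqPQ) sub0r mulrN1 subr_ge0 ge_min lexx.
  by rewrite subr0 addr_ge0 // mulr_ge0 ?ler0n // ltW.
have loady e : load y e = load x e + eps * dl e.
  by rewrite /load big_split /= -mulr_sumr sumrB !sum_delta.
have DE : \sum_e dl e * exp_edge_cost mu e (load x e) = - D.
  rewrite opprB /exp_path_cost /dl; under eq_bigr do rewrite mulrBl.
  by rewrite sumrB; congr (_ - _); rewrite [RHS]big_mkcond; apply: eq_bigr => e _;
     case: ifP; rewrite ?mul1r ?mul0r.
have potE : potential mu y = potential mu x + eps * (eps * K - D).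
  rewrite mulrDr -DE /K /potential !mulr_sumr -!big_split /=.
  by apply: eq_bigr => e _; rewrite loady exp_edge_costE; field.
have := xmin _ yF; rewrite potE lerDl pmulr_rge0 // subr_ge0; apply/negP.
rewrite -ltNge; apply: (@le_lt_trans _ _ (D / (K + 1) * K)).
  by rewrite ler_wpM2r // ge_min lexx orbT.
have K1 : 0 < K + 1 by rewrite ltr_wpDl.
by rewrite mulrAC ltr_pdivrMr // ltr_pM2l // ltrDl.
Qed.

Definition equilibrium (R : realType) (G : game R) (mu : belief G) :
    spath G -> R :=
  projT1 (cid (wardrop_exists mu)).

Lemma equilibriumP (R : realType) (G : game R) (mu : belief G) :
  wardrop mu (equilibrium mu).
Proof. exact: projT2 (cid (wardrop_exists mu)). Qed.

Definition equilibrium_cost (R : realType) (G : game R) (mu : belief G) : R :=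
  total_cost mu (equilibrium mu).

(* equilibrium_cost does not depend on the choice of the equilibrium. *)
Lemma equilibrium_costE (R : realType) (G : game R) (mu : belief G)
    (x : spath G -> R) : wardrop mu x -> equilibrium_cost mu = total_cost mu x.
Proof.
move=> xW; apply: eq_bigr => e _.
by rewrite (wardrop_load_unique (equilibriumP mu) xW).
Qed.

(* Main.v *)
(* Divided by the first moment of mu, the edge costs read a_e (r x_e) + b_e with
   r := moment2 mu / moment1 mu, so the equilibrium is a rescaled equilibrium of
   the deterministic game with demand r, and C(mu) / moment1 mu is the path cost
   L(r) there.  The variational inequality for the equilibria f and g at demands
   r < s, tested against each other, yields
     0 <= sum_e (g_e - f_e) (c_e(g_e) - c_e(f_e)) <= (s - r) (L(s) - L(r)),
   so L is nondecreasing; multiply by the first moment. *)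
Require Import Defs.
From mathcomp Require Import all_boot all_order all_algebra.
From mathcomp Require Import all_classical all_reals all_analysis.
From mathcomp Require Import ring lra.

Import Order.TTheory GRing.Theory Num.Theory.

Local Open Scope ring_scope.

(** A zero first moment would force every [mu th * demand G th] to vanish, and with it the second
    moment. *)
Lemma moment1_gt0 {R : realType} {G : game R} (mu : belief G) :
  0 < moment1 mu.
Proof.
have m0 th : 0 <= mu th * demand G th.
  by rewrite mulr_ge0 ?prob_ge0 // ltW ?demand_gt0.
rewrite lt_neqAle sumr_ge0 // andbT eq_sym; apply/eqP => m1.
have := moment2_gt0 mu; rewrite /moment2 big1 ?ltxx // => th _.
have m th' := @psumr_eq0P _ _ xpredT _ (fun i _ => m0 i) m1 th' isT.
by rewrite expr2 mulrA m mul0r.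
Qed.

Lemma load_ge0 {R : realType} {G : game R} (x : spath G -> R) (e : edge G) :
  path_flow x -> 0 <= load x e.
Proof. by case=> x0 _; apply: sumr_ge0. Qed.

Lemma total_cost_ge0 {R : realType} {G : game R} (mu : belief G)
    (x : spath G -> R) : path_flow x -> 0 <= total_cost mu x.
Proof.
move=> xF; apply: sumr_ge0 => e _; have x0 := load_ge0 x e xF.
rewrite exp_edge_costE mulr_ge0 // addr_ge0 // !mulr_ge0 //.
- exact/ltW/slope_gt0.
- exact/ltW/moment2_gt0.
- exact: offset_ge0.
- exact/ltW/moment1_gt0.
Qed.

(** Variational inequality in edge form: both sides are averages of path costs at [x], and an
    equilibrium uses only cheapest paths. *)
Lemma wardrop_total_cost_le {R : realType} {G : game R} (mu : belief G)
    (x y : spath G -> R) : wardrop mu x -> path_flow y ->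
  total_cost mu x <= \sum_e load y e * exp_edge_cost mu e (load x e).
Proof.
by move=> xW yF; rewrite /total_cost !load_sumE; exact: wardrop_le.
Qed.

Lemma normalized_cost_le {R : realType} {G : game R} {mu nu : belief G}
    {x y : spath G -> R} : wardrop mu x -> wardrop nu y ->
  moment2 mu / moment1 mu < moment2 nu / moment1 nu ->
  total_cost mu x / moment1 mu <= total_cost nu y / moment1 nu.
Proof.
move=> xW yW; set r := _ / moment1 mu; set s := _ / moment1 nu => lt_rs.
have p0 := moment1_gt0 mu; have q0 := moment1_gt0 nu.
have r0 : 0 < r by rewrite divr_gt0 ?moment2_gt0.
have s0 : 0 < s by rewrite divr_gt0 ?moment2_gt0.
pose X := \sum_e load y e * exp_edge_cost mu e (load x e) / moment1 mu.
pose Y := \sum_e load x e * exp_edge_cost nu e (load y e) / moment1 nu.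
have leX : total_cost mu x / moment1 mu <= X.
  by rewrite /X -mulr_suml ler_pM2r ?invr_gt0 //; exact: wardrop_total_cost_le xW yW.1.
have leY : total_cost nu y / moment1 nu <= Y.
  by rewrite /Y -mulr_suml ler_pM2r ?invr_gt0 //; exact: wardrop_total_cost_le yW xW.1.
(* The offsets cancel inside each bracket; the weights [s] and [r] complete the slope terms to a
   square in the rescaled loads. *)
have : 0 <= s * (total_cost nu y / moment1 nu - X)
            + r * (total_cost mu x / moment1 mu - Y).
  rewrite /total_cost !mulr_suml -!sumrB !mulr_sumr -big_split /=.
  apply: sumr_ge0 => e _.
  rewrite [X in 0 <= X](_ : _ =
    slope G e * (s * load y e - r * load x e) ^+ 2).
    by rewrite mulr_ge0 ?sqr_ge0 // ltW ?slope_gt0.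
  by rewrite !exp_edge_costE /r /s; field; rewrite !gt_eqF.
move: leX leY; set A := _ / moment1 mu; set B := _ / moment1 nu => leX leY sum0.
have : 0 <= (s - r) * (B - A).
  apply: le_trans sum0 _.
  (* Replacing [X] by [A] and [Y] by [B] only increases the sum, which becomes
     [s * (B - A) + r * (A - B)]. *)
  have := ler_wpM2l (ltW s0) leX; have := ler_wpM2l (ltW r0) leY; lra.
by rewrite pmulr_rge0 ?subr_gt0 // subr_ge0.
Qed.

Theorem lemma2 (R : realType) (G : game R) (mu1 mu2 : belief G)
    (hratio : (\sum_th mu1 th * demand G th ^+ 2) / (\sum_th mu1 th * demand G th)
            < (\sum_th mu2 th * demand G th ^+ 2) / (\sum_th mu2 th * demand G th))
    (hmean : \sum_th mu1 th * demand G th < \sum_th mu2 th * demand G th) :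
  equilibrium_cost mu1 <= equilibrium_cost mu2.
Proof.
have leL := normalized_cost_le (equilibriumP mu1) (equilibriumP mu2) hratio.
have p0 := moment1_gt0 mu1; have q0 := moment1_gt0 mu2.
have C0 := total_cost_ge0 mu1 _ (equilibriumP mu1).1.
(* Each cost is split as normalized cost times first moment; both factors are nonnegative and grow
   from [mu1] to [mu2]. *)
rewrite /equilibrium_cost -(divfK (lt0r_neq0 p0) (total_cost mu1 _)).
rewrite -(divfK (lt0r_neq0 q0) (total_cost mu2 _)).
by apply: ler_pM => //; [rewrite divr_ge0 // ltW | exact: ltW | exact: ltW].
Qed.
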